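(* Let $m,n$ be positive integers. A polynomial vector field $(P_1,\ldots,P_{n+1})$ on $\mathbb{S}^n$ is homogeneous of degree $m$ if and only if $P_i=\sum_{j=1}^{n+1}A_{ij}x_j$ for $i=1,\ldots,n+1$, where $(A_{ij})$ is a skew-symmetric $(n+1)\times(n+1)$ matrix with entries in $\mathbb{R}[x_1,\ldots,x_{n+1}]$ and each $A_{ij}$ is either zero or a homogeneous polynomial of degree $m-1$.
   Context: $\mathbb{S}^n=\{x\in\mathbb{R}^{n+1} : \sum_i x_i^2=1\}$. A polynomial vector field $\chi=(P_1,\ldots,P_{n+1})$ in $\mathbb{R}^{n+1}$ is identified with the operator $\sum_i P_i\,\partial/\partial x_i$; it is homogeneous of degree $m$ if $P_1,\ldots,P_{n+1}$ are homogeneous polynomials of the same degree $m$ (the zero polynomial being allowed as homogeneous of any degree). It is a vector field on $\mathbb{S}^n$ if $\chi(\sum_i x_i^2-1)=K(\sum_i x_i^2-1)$ for some real polynomial $K$. *)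

(* Defs.v *)
From mathcomp Require Import all_boot all_order all_algebra.
From mathcomp Require Import reals.
From mathcomp Require Export mpoly.

Set Implicit Arguments.
Unset Strict Implicit.
Unset Printing Implicit Defensive.

Import GRing.Theory.
Local Open Scope ring_scope.

Section PolynomialVectorFields.
Variables (R : realType) (d : nat).

Definition vector_field := 'I_d -> {mpoly R[d]}.

Definition vf_apply (P : vector_field) (f : {mpoly R[d]}) : {mpoly R[d]} :=
  \sum_(i < d) P i * f^`M(i).

Definition sphere_poly : {mpoly R[d]} := (\sum_(i < d) 'X_i ^+ 2) - 1.

Definition on_sphere (P : vector_field) : Prop :=
  exists K : {mpoly R[d]}, vf_apply P sphere_poly = K * sphere_poly.

(* The zero polynomial is [m.-homog] for every [m]. *)
Definition homogeneous_field (m : nat) (P : vector_field) : Prop :=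
  forall i, P i \is m.-homog.

End PolynomialVectorFields.

Definition skew_symmetric (V : zmodType) (d : nat) (A : 'M[V]_d) : Prop :=
  A^T = - A.

(* Main.v *)
Require Import Defs.
From mathcomp Require Import all_boot all_order all_algebra.
From mathcomp Require Import reals mpoly.
From mathcomp Require Import ring.
Local Open Scope ring_scope.
Set Implicit Arguments.
Unset Strict Implicit.
Unset Printing Implicit Defensive.
Import GRing.Theory Num.Theory.

(** If every [A i j] is homogeneous of degree [m - 1], the products
    [A i j * 'X_j] are homogeneous of degree [m], which settles one direction.

    For the other one, let [S = |x|^2 - 1]. As [vf_apply P S] equals
    [2 \sum_i P_i x_i], tangency says that the homogeneous polynomial
    [Q = 2 \sum_i P_i x_i] is a multiple of [S], and this forces [Q = 0]
    ([homogeneous_on_sphere_tangent]): a homogeneous polynomial that vanishes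
    on the sphere vanishes on every ray that meets it. Algebraically, the
    radial derivative [euler] multiplies [Q] by its degree, hence preserves
    the order to which [Q] vanishes along [S = 0]; on the other hand it lowers
    any finite positive order of vanishing by one, because
    [euler S = 2 (S + 1)] is prime to [S]. So every power of [S] divides [Q],
    and a nonzero polynomial has no divisors of arbitrarily large degree.

    It remains to write [P] with [\sum_i P_i x_i = 0] as a skew-symmetric
    matrix applied to [x]. This is exactness of the Koszul complex, for which
    homogeneity supplies an explicit contraction: the matrix
    [(d_j P_i - d_i P_j) / (m + 1)] works ([koszul_homog]). *)

(** * The Euler operator *)

Section Euler.
Variables (d : nat) (R : comNzRingType).
Implicit Types p q : {mpoly R[d]}.

Definition euler p := \sum_(i < d) p^`M(i) * 'X_i.

Lemma mderivXU (i j : 'I_d) : ('X_j : {mpoly R[d]})^`M(i) = (i == j)%:R.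
Proof.
rewrite mderivX mnm1E [j == i]eq_sym; case: eqP => [->|_]; last by rewrite scale0r.
by rewrite -[X in (X - _)%MM]add0m addmK scale1r mpolyX0.
Qed.

Lemma dhomogXU (i : 'I_d) : ('X_i : {mpoly R[d]}) \is 1.-homog.
Proof. by rewrite dhomogX; apply/eqP; exact: mdeg1. Qed.

(** Euler's identity: monomials are eigenvectors of [euler], with their degree as
    eigenvalue. *)
Lemma euler_homog e p : p \is e.-homog -> euler p = p *+ e.
Proof.
move=> /dhomogP hp; rewrite /euler {2}[p]mpolyE.
rewrite /mderiv; under eq_bigr => i _ do rewrite mulr_suml.
rewrite exchange_big /= -sumrMnl; apply: eq_big_seq => m /hp <-.
(* The exponent is stated through the bundled degree measure. *)
rewrite -[X in _ *+ X]/(mdeg m) mdegE -sumrMnr; apply: eq_bigr => i _.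
have [m0|mi] := posnP (m i); first by rewrite m0 mul0r scale0r mul0r mulr0n.
rewrite -scalerAl -mpolyXD submK; first by rewrite mulr_natl scalerMnl.
by apply/mnm_lepP => j; rewrite mnm1E; case: eqP => // <-.
Qed.

Lemma eulerM p q : euler (p * q) = euler p * q + p * euler q.
Proof.
rewrite /euler mulr_suml mulr_sumr -big_split /=; apply: eq_bigr => i _.
by rewrite mderivM; ring.
Qed.

Lemma euler_exp p k : euler (p ^+ k.+1) = p ^+ k * euler p *+ k.+1.
Proof.
elim: k => [|k IH]; first by rewrite expr0 mul1r expr1.
by rewrite exprS eulerM IH exprS; ring.
Qed.

Lemma dhomog_mderiv e p i : p \is e.-homog -> p^`M(i) \is e.-1.-homog.
Proof.
move=> hp; apply/dhomogP => m; rewrite mcoeff_msupp mcoeff_deriv => nz.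
have: (m + U_(i))%MM \in msupp p.
  by rewrite mcoeff_msupp; apply: contraNneq nz => ->; rewrite mul0rn.
move=> /(dhomog_mf hp); rewrite -[LHS]/(mdeg (m + U_(i))) => <-.
by rewrite mdegD mdeg1 addn1.
Qed.
End Euler.

(** * Homogeneous multiples of an inhomogeneous polynomial *)

(** The identity obtained by applying a derivation to [t s^b], where [t']
    stands for the derivative of [t], [w] for [s^(b-1)] and [(s + 1) *+ a] for the
    derivative of [s]. It is kept over an abstract ring so that normalisation
    need not look inside multivariate polynomials. *)
Lemma radial_order_identity (T : comNzRingType) (a b e : nat) (t t' s w : T) :
  t' * (s * w) + t * (w * ((s + 1) *+ a) *+ b) = t * (s * w) *+ e ->
  t *+ (a * b) * w = (t *+ e - t' - t *+ (a * b)) * s * w.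
Proof.
move=> H; apply/eqP; rewrite -subr_eq0 -[X in _ == X](subrr (t * (s * w) *+ e)).
rewrite -[X in _ == X - _]H; apply/eqP.
by ring.
Qed.

Section Divisibility.
Variables (d : nat) (R : numFieldType).
Implicit Types p q s : {mpoly R[d]}.

(** Applying [euler] to [q = t s^(k+1)] and using [euler q = e q] gives
    [e t s = euler t s + a (k+1) t (s + 1)] after cancelling [s^k], so that
    [s] divides [a (k+1) t]; in characteristic zero it divides [t]. *)
Lemma homog_dvd_expS e a k q s t : a != 0%N ->
  q \is e.-homog -> euler s = (s + 1) *+ a -> q = t * s ^+ k.+1 -> s != 0 ->
  exists t', q = t' * s ^+ k.+2.
Proof.
move=> a0 hq Es qE s0.
pose u := t *+ e - euler t - t *+ (a * k.+1).
have c0 : (a * k.+1)%:R != 0 :> R by rewrite pnatr_eq0 muln_eq0 negb_or a0.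
have tE : t *+ (a * k.+1) = u * s.
  have sk0 : s ^+ k != 0 by rewrite expf_neq0.
  apply: (mulIf sk0); apply: radial_order_identity.
  by rewrite -Es -exprS -euler_exp -eulerM -qE (euler_homog hq).
exists ((a * k.+1)%:R^-1 *: u).
rewrite exprS mulrA -scalerAl -tE -scaler_nat scalerA mulVf // scale1r.
exact: qE.
Qed.

(** The exponent [msize q + 1] already makes the divisor too large. *)
Lemma dvd_all_exp_eq0 q s : (1 < msize s)%N ->
  (forall k, exists t, q = t * s ^+ k.+1) -> q = 0.
Proof.
move=> s1 H; apply/eqP; apply: contraT => q0.
have s0 : s != 0 by apply: contraTneq s1 => ->; rewrite msize0.
have szX k : (k < msize (s ^+ k))%N.
  elim: k => [|k IH]; first by rewrite expr0 msize1.
  rewrite exprS msizeM ?expf_neq0 //; case: (msize s) s1 => [//|[//|b]] _.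
  by rewrite !addSn /=; apply: leq_trans IH _; rewrite leq_addl.
have [t qE] := H (msize q).
have t0 : t != 0 by apply: contraNneq q0 => t0; rewrite qE t0 mul0r.
have szq : msize q = (msize t + msize (s ^+ (msize q).+1)).-1.
  by rewrite {1}qE msizeM ?expf_neq0.
have szs := ltnW (szX (msize q).+1).
have : (msize q < msize q)%N; last by rewrite ltnn.
rewrite {2}szq; apply: leq_trans szs _.
by move: t0; rewrite -msize_poly_eq0; case: (msize t) => // b _; exact: leq_addl.
Qed.

(** The hypothesis on [euler s] says that [s + 1] behaves like a homogeneous
    polynomial of degree [a]; the prototype is [s = |x|^2 - 1] with [a = 2]. *)
Lemma homog_dvd_eq0 e a q s t : a != 0%N -> (1 < msize s)%N ->
  q \is e.-homog -> euler s = (s + 1) *+ a -> q = t * s -> q = 0.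
Proof.
move=> a0 s1 hq Es qE; apply: (dvd_all_exp_eq0 s1).
have s0 : s != 0 by apply: contraTneq s1 => ->; rewrite msize0.
elim=> [|k [t' IH]]; first by exists t; rewrite expr1.
exact: homog_dvd_expS a0 hq Es IH s0.
Qed.
End Divisibility.

(** * The Koszul contraction *)

(** Summed against [x_j], the terms [d_j P_i] give [m P_i] by Euler's identity,
    while differentiating [\sum_j P_j x_j = 0] with respect to [x_i] shows that
    the terms [d_i P_j] give [- P_i]; the difference is [(m + 1) P_i]. *)
Lemma koszul_homog (R : numFieldType) (d m : nat) (P : 'I_d -> {mpoly R[d]}) :
  (forall i, P i \is m.-homog) -> \sum_(i < d) P i * 'X_i = 0 ->
  forall i, P i =
    \sum_(j < d) (m.+1%:R^-1 *: ((P i)^`M(j) - (P j)^`M(i))) * 'X_j.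
Proof.
move=> hP P0 i.
have dP0 : \sum_(j < d) (P j)^`M(i) * 'X_j = - P i.
  apply/eqP; rewrite eq_sym -subr_eq0 -opprD oppr_eq0; apply/eqP.
  rewrite -[RHS](mderiv0 _ i) -[in RHS]P0 raddf_sum /=.
  under [RHS]eq_bigr => j _ do rewrite mderivM mderivXU.
  rewrite big_split /= addrC; congr (_ + _).
  rewrite (bigD1 i) //= eqxx mulr1 big1 ?addr0 // => j ji.
  by rewrite eq_sym (negPf ji) mulr0.
under eq_bigr => j _ do rewrite -scalerAl mulrBl.
rewrite -scaler_sumr sumrB dP0 opprK -/(euler (P i)) (euler_homog (hP i)).
by rewrite -mulrSr -scaler_nat scalerA mulVf ?scale1r // pnatr_eq0.
Qed.

(** * Tangency to the sphere *)

Section Sphere.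
Variables (R : realType) (d : nat).
Notation S := (sphere_poly R d).

Lemma mderiv_sphere i : S^`M(i) = 'X_i *+ 2.
Proof.
rewrite /sphere_poly mderivB -mpolyC1 mderivC subr0 raddf_sum /= (bigD1 i) //=.
rewrite big1 => [|j ji].
  by rewrite addr0 expr2 mderivM mderivXU eqxx mul1r mulr1.
by rewrite expr2 mderivM mderivXU eq_sym (negPf ji) mul0r mulr0 addr0.
Qed.

Lemma euler_sphere : euler S = (S + 1) *+ 2.
Proof.
rewrite /sphere_poly subrK -sumrMnl; apply: eq_bigr => i _.
by rewrite mderiv_sphere mulrnAl expr2.
Qed.

(** A constant would have zero partial derivatives, unlike [S]. *)
Lemma msize_sphere : (0 < d)%N -> (1 < msize S)%N.
Proof.
move=> d0; rewrite ltnNge; apply/negP => /msize1_polyC SC.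
have := mderiv_sphere (Ordinal d0); rewrite SC mderivC => /esym/eqP.
rewrite -scaler_nat scaler_eq0 pnatr_eq0 /= => /eqP/(congr1 (fun p : {mpoly R[d]} => msize p)).
by rewrite msizeX msize0.
Qed.

Lemma vf_apply_sphere (P : vector_field R d) :
  vf_apply P S = (\sum_(i < d) P i * 'X_i) *+ 2.
Proof.
rewrite /vf_apply -sumrMnl; apply: eq_bigr => i _.
by rewrite mderiv_sphere mulrnAr.
Qed.

(** The cofactor [K] of a homogeneous field vanishes: tangency to the unit
    sphere amounts to tangency to every concentric sphere. *)
Lemma homogeneous_on_sphere_tangent m (P : vector_field R d) : (0 < d)%N ->
  on_sphere P -> homogeneous_field m P -> \sum_(i < d) P i * 'X_i = 0.
Proof.
move=> d0 [K PK] hP.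
have hQ : vf_apply P S \is (m + 1).-homog.
  rewrite vf_apply_sphere rpredMn // rpred_sum // => i _.
  by apply: dhomogM => //; exact: dhomogXU.
have := homog_dvd_eq0 (isT : 2 != 0)%N (msize_sphere d0) hQ euler_sphere PK.
by rewrite vf_apply_sphere -scaler_nat => /eqP; rewrite scaler_eq0 pnatr_eq0 => /eqP.
Qed.
End Sphere.

Theorem theorem5p4 (R : realType) (m n : nat) (hm : (0 < m)%N) (hn : (0 < n)%N)
    (P : vector_field R n.+1) (hP : on_sphere P) :
  homogeneous_field m P <->
  exists A : 'M[{mpoly R[n.+1]}]_n.+1,
    [/\ skew_symmetric A,
        forall i j, A i j = 0 \/ A i j \is m.-1.-homog &
        forall i, P i = \sum_(j < n.+1) A i j * 'X_j].
Proof.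
split=> [homP | [A [_ homA PE]] i]; last first.
  rewrite PE rpred_sum // => j _.
  have [-> | hA] := homA i j; first by rewrite mul0r rpred0.
  by have := dhomogM hA (@dhomogXU _ R j); rewrite addn1 prednK.
have tP := homogeneous_on_sphere_tangent (ltn0Sn n) hP homP.
exists (\matrix_(i, j) (m.+1%:R^-1 *: ((P i)^`M(j) - (P j)^`M(i)))); split.
- by apply/matrixP => i j; rewrite !mxE -scalerN opprB.
- by move=> i j; right; rewrite mxE rpredZ // rpredB // dhomog_mderiv.
- move=> i; rewrite {1}(koszul_homog homP tP i).
  by apply: eq_bigr => j _; rewrite mxE.
Qed.
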